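(* Let $G$ be a finite, simple, connected regular graph with diameter $D$ and largest eigenvalue $\lambda_0$, and let $m\le D$ be a positive integer. If $G$ is $(m-1)$-partially distance-regular, then $\overline{k}_m\ge p_m(\lambda_0)$, with equality if and only if $G$ is $m$-partially distance-regular.
   Context: Let $G$ be a finite, simple, connected graph on $n$ vertices with adjacency matrix $A$, whose distinct eigenvalues are $\lambda_0>\cdots>\lambda_d$ with multiplicities $m_0,\ldots,m_d$; the diameter satisfies $D\le d$. On the space $\mathbb{R}_d[x]$ of real polynomials of degree at most $d$ use the scalar product $\langle p,q\rangle_G=\frac1n\operatorname{tr}(p(A)q(A))=\frac1n\sum_{i=0}^d m_i p(\lambda_i)q(\lambda_i)$. The predistance polynomials $p_0,\ldots,p_d$ are the unique orthogonal sequence with $\deg p_i=i$ and $\|p_i\|_G^2=p_i(\lambda_0)$. For $i=0,\ldots,D$, $A_i$ is the distance-$i$ matrix: $(A_i)_{uv}=1$ if $\operatorname{dist}(u,v)=i$ and $0$ otherwise. $G$ is called $m$-partially distance-regular ($0\le m\le D$) if $p_i(A)=A_i$ for every $i\le m$. $k_i(u)$ is the number of vertices at distance $i$ from $u$, and $\overline{k}_i=\frac1n\sum_{u\in V}k_i(u)$. *)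

(* Defs.v *)
From mathcomp Require Import all_boot all_order all_algebra.
From mathcomp Require Import polyrcf.

Set Implicit Arguments.
Unset Strict Implicit.
Unset Printing Implicit Defensive.

Import Order.TTheory GRing.Theory Num.Theory.
Local Open Scope ring_scope.

(* A nonempty finite simple graph is a symmetric irreflexive adjacency relation
   on the vertex set 'I_n.+1; so the number of vertices is n.+1, never n. *)

Section Graph.

Variables (n : nat) (e : rel 'I_n.+1).

Definition connected_graph : Prop := forall u v, connect e u v.

Definition regular_graph : Prop :=
  exists k : nat, forall u, #|[set v | e u v]| = k.

Definition walk (k : nat) (u v : 'I_n.+1) : bool :=
  [exists s : k.-tuple 'I_n.+1, path e u s && (last u s == v)].

(* The least k such that walk k u v, which is at most n if it exists; when v is
   not reachable from u, the value is n.+1. *)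
Definition dist (u v : 'I_n.+1) : nat :=
  find (fun k => walk k u v) (iota 0 n.+1).

Definition diameter : nat := \max_u \max_v dist u v.

Definition k_ (i : nat) (u : 'I_n.+1) : nat := #|[set v | dist u v == i]|.

End Graph.

Section Spectrum.

Variables (R : rcfType) (n : nat) (e : rel 'I_n.+1).

Definition adjacency : 'M[R]_n.+1 := \matrix_(u, v) (e u v)%:R.

Definition distance_mx (i : nat) : 'M[R]_n.+1 :=
  \matrix_(u, v) (dist e u v == i)%:R.

Definition kbar (i : nat) : R := (\sum_u (k_ e i u)%:R) / n.+1%:R.

(* rootsR lists the distinct roots in increasing order. *)
Definition spectrum : seq R := rev (rootsR (char_poly adjacency)).

Lemma mem_spectrum (a : R) : (a \in spectrum) = eigenvalue adjacency a.
Proof.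
rewrite mem_rev eigenvalue_root_char.
have nz : char_poly adjacency != 0 by rewrite monic_neq0 ?char_poly_monic.
by rewrite -(roots_on_rootsR nz a) inE.
Qed.

Lemma sorted_spectrum : sorted >%R spectrum.
Proof. by rewrite rev_sorted; exact: sorted_roots. Qed.

Definition lambda (i : nat) : R := nth 0 spectrum i.

Definition d_ : nat := (size spectrum).-1.

Definition scalar_product (p q : {poly R}) : R :=
  \tr (horner_mx adjacency p *m horner_mx adjacency q) / n.+1%:R.

(* Only p 0, ..., p d_ are constrained; size is one more than the degree. *)
Definition predistance_polynomials (p : nat -> {poly R}) : Prop :=
  [/\ forall i, (i <= d_)%N -> size (p i) = i.+1,
      forall i j, (i <= d_)%N -> (j <= d_)%N -> i != j ->
        scalar_product (p i) (p j) = 0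
    & forall i, (i <= d_)%N -> scalar_product (p i) (p i) = (p i).[lambda 0]].

(* p is meant to be the sequence of predistance polynomials of e. *)
Definition partially_distance_regular (p : nat -> {poly R}) (m : nat) : Prop :=
  (m <= diameter e)%N /\
  forall i, (i <= m)%N -> horner_mx adjacency (p i) = distance_mx i.

End Spectrum.

(* Main.v *)
(* With <M, N> = tr (M N^T) / n, one shows
     kbar_m - p_m(lambda_0) = ||A_m - p_m(A)||^2,
   from which both claims are immediate.  As ||A_m||^2 = kbar_m and
   ||p_m(A)||^2 = p_m(lambda_0), this amounts to <A_m, p_m(A)> = p_m(lambda_0).
   By regularity <J, p_m(A)> = p_m(lambda_0) for the all-ones matrix J, the sum
   of the A_i.  The terms i < m contribute <p_i(A), p_m(A)> = 0, and those with
   i > m vanish because p_m(A) has degree m in A.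
   The predistance polynomials are constrained only up to index d, so D <= d is
   needed too: the symmetric matrix A is annihilated by the product of the
   X - lambda_i, of degree d + 1, while A^D has a nonzero entry where all lower
   powers of A vanish. *)

Require Import Defs.
From mathcomp Require Import all_boot all_order all_algebra.
From mathcomp Require Import complex.

Set Implicit Arguments.
Unset Strict Implicit.

Import Order.TTheory GRing.Theory Num.Theory.
Local Open Scope ring_scope.

(** * Polynomials evaluated at a matrix *)

Lemma horner_mx_sum (R : comNzRingType) (n : nat) (B : 'M[R]_n.+1)
    (q : {poly R}) :
  horner_mx B q = \sum_(i < size q) q`_i *: B ^+ i.
Proof.
rewrite -{1}[q]coefK poly_def rmorph_sum /=; apply: eq_bigr => i _.
by rewrite horner_mxZ rmorphXn /= horner_mx_X.
Qed.

Lemma trmx_exp (R : comNzRingType) (n : nat) (B : 'M[R]_n.+1) (k : nat) :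
  (B ^+ k)^T = B^T ^+ k.
Proof.
elim: k => [|k IHk]; first by rewrite !expr0 trmx1.
by rewrite exprS exprSr -!mulmxE trmx_mul IHk.
Qed.

Lemma trmx_horner_mx (R : comNzRingType) (n : nat) (B : 'M[R]_n.+1)
    (q : {poly R}) :
  (horner_mx B q)^T = horner_mx B^T q.
Proof.
rewrite !horner_mx_sum linear_sum /=; apply: eq_bigr => i _.
by rewrite linearZ /= trmx_exp.
Qed.

(* Diagonalize over the algebraically closed field R[i]; the spectrum of a
   Hermitian matrix is real. *)
Lemma symmetric_annihilator (R : rcfType) (n : nat) (B : 'M[R]_n.+1)
    (s : seq R) :
  B^T = B -> (forall a, eigenvalue B a -> a \in s) ->
  horner_mx B (\prod_(a <- s) ('X - a%:P)) = 0.
Proof.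
move=> Bsym Bs.
pose C : numClosedFieldType := R[i]%C.
pose f : {rmorphism R -> C} := real_complex R.
pose BC := map_mx f B.
have BCherm : BC \is hermsymmx.
  apply: realsym_hermsym.
    apply/is_hermitianmxP; rewrite expr0 scale1r map_mx_id //.
    by rewrite /BC map_trmx Bsym.
  apply/mxOverP => i j; rewrite mxE; apply/complex_realP.
  by exists (B i j).
have BCE := orthomx_spectralP (hermitian_normalmx BCherm).
have dreal := hermitian_spectral_diag_real BCherm.
set P := spectralmx BC in BCE; set d := spectral_diag BC in BCE dreal.
have Punit : P \is a GRing.unit by apply: spectral_unit.
apply: (map_mx_inj (f := f)); rewrite map_mx0 map_horner_mx -/BC.
rewrite BCE horner_mx_uconjC // horner_mx_diag.
suff -> : map_mx (horner (map_poly f (\prod_(a <- s) ('X - a%:P)))) d = 0.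
  by rewrite raddf0 mulmx0 mul0mx.
apply/matrixP => i j; rewrite !mxE (ord1 i).
have /complex_realP[x dx] := mxOverP dreal 0 j.
(* [BC] is the conjugate by [P] of a diagonal matrix, so row [j] of [P] is a left eigenvector; it is
   nonzero because [P] is invertible. *)
have ev : eigenvalue BC (d 0 j).
  apply/eigenvalueP; exists (row j P).
    rewrite {1}BCE !mulmxA -row_mul mulmxV // row1 -rowE row_diag_mx.
    by rewrite -scalemxAl -rowE.
  apply/eqP => r0; have := row_free_unit P; rewrite [X in _ = X]Punit.
  move=> /row_freeP[Q PQ]; have := congr1 (mulmx^~ Q) r0.
  rewrite -row_mul PQ mul0mx => /rowP/(_ j)/eqP.
  by rewrite !mxE eqxx oner_eq0.
(* Since [d 0 j] is the image of the real [x], [x] is already an eigenvalue of [B]. *)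
have xs : x \in s.
  by apply: Bs; rewrite -(eigenvalue_map f) -/BC -[f x]/(x%:C)%C -dx.
rewrite dx -[(x%:C)%C]/(f x) horner_map.
suff /eqP -> : root (\prod_(a <- s) ('X - a%:P)) x by rewrite rmorph0.
by rewrite root_prod_XsubC.
Qed.

(** * Walks and distance *)

Section Walks.

Variables (n : nat) (e : rel 'I_n.+1).

Lemma walkP (k : nat) (u v : 'I_n.+1) :
  reflect (exists s, [/\ size s = k, path e u s & last u s = v]) (walk e k u v).
Proof.
apply: (iffP existsP) => [[s /andP[es /eqP ls]]|[s [ss es ls]]].
  by exists s; rewrite size_tuple.
have ss' : size s == k by apply/eqP.
by exists (Tuple ss'); rewrite /= es ls eqxx.
Qed.

Lemma walk0 (u v : 'I_n.+1) : walk e 0 u v = (u == v).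
Proof.
apply/walkP/eqP => [[s [/size0nil -> _ <-]] // | ->].
by exists [::].
Qed.

Lemma walkS (k : nat) (u v : 'I_n.+1) :
  walk e k.+1 u v = [exists w, e u w && walk e k w v].
Proof.
apply/walkP/existsP => [[[|w s] [] //= [ss] /andP[euw es] ls]|].
  by exists w; rewrite euw; apply/walkP; exists s.
move=> [w /andP[euw /walkP[s [ss es ls]]]].
by exists (w :: s); rewrite /= ss euw.
Qed.

Lemma walk_lt_dist (k : nat) (u v : 'I_n.+1) :
  (k < dist e u v)%N -> ~~ walk e k u v.
Proof.
move=> ltk; have := before_find 0 ltk; rewrite nth_iota ?add0n => [->|] //.
by rewrite -[n.+1](size_iota 0) (leq_trans ltk) // find_size.
Qed.

Lemma walk_dist (u v : 'I_n.+1) :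
  connected_graph e -> walk e (dist e u v) u v.
Proof.
move=> /(_ u v)/connectP[s es vE].
have hasw : has (fun k => walk e k u v) (iota 0 n.+1).
  (* A path without repeated vertices has length at most [n], within the range searched by
     [dist]. *)
  case/shortenP: es vE => t et ut _ vE.
  apply/hasP; exists (size t); last by apply/walkP; exists t.
  rewrite mem_iota add0n /=.
  by have := max_card (mem (u :: t)); rewrite card_ord (card_uniqP ut).
have := nth_find 0 hasw; rewrite nth_iota ?add0n //.
by move: hasw; rewrite has_find size_iota.
Qed.

Lemma diameter_witness : exists u v, dist e u v = diameter e.
Proof.
have lt0 : (0 < #|{: 'I_n.+1}|)%N by rewrite card_ord.
have [u uE] := bigop.eq_bigmax (I := 'I_n.+1) (fun u => \max_v dist e u v)%N lt0.
have [v vE] := bigop.eq_bigmax (I := 'I_n.+1) (dist e u) lt0.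
by exists u, v; rewrite /diameter uE vE.
Qed.

End Walks.

(** * Powers of the adjacency matrix and the spectrum of a regular graph *)

Section Adjacency.

Variables (R : rcfType) (n : nat) (e : rel 'I_n.+1).
Notation A := (adjacency R e).
Notation dm := (distance_mx R e).

Lemma adjacency_exp_ge0 (k : nat) (u v : 'I_n.+1) : 0 <= (A ^+ k) u v.
Proof.
elim: k u v => [|k IHk] u v; first by rewrite expr0 mxE ler0n.
by rewrite exprS mxE sumr_ge0 // => w _; rewrite mulr_ge0 // mxE ler0n.
Qed.

(** The entries of [A ^+ k] count walks; all terms are nonnegative, so none cancel. *)
Lemma adjacency_exp_neq0 (k : nat) (u v : 'I_n.+1) :
  ((A ^+ k) u v != 0) = walk e k u v.
Proof.
elim: k u v => [|k IHk] u v.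
  by rewrite expr0 walk0 mxE pnatr_eq0 eqb0 negbK.
rewrite exprS walkS mxE psumr_neq0 => [|w _]; last first.
  by rewrite mulr_ge0 ?adjacency_exp_ge0 // mxE ler0n.
apply/hasP/existsP => [[w _]|[w /andP[euw wv]]].
  rewrite /= lt0r mulf_eq0 negb_or => /andP[/andP[Auw Awv] _]; exists w.
  by move: Auw; rewrite mxE pnatr_eq0 eqb0 negbK -IHk Awv andbT.
exists w; first by rewrite mem_index_enum.
rewrite /= mxE euw mul1r lt0r IHk wv; exact: adjacency_exp_ge0.
Qed.

Lemma adjacency_exp_eq0 (k : nat) (u v : 'I_n.+1) :
  (k < dist e u v)%N -> (A ^+ k) u v = 0.
Proof.
by move=> /walk_lt_dist; rewrite -(adjacency_exp_neq0 k u v) negbK => /eqP.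
Qed.

Lemma horner_adjacency_eq0 (q : {poly R}) (u v : 'I_n.+1) :
  (size q <= dist e u v)%N -> horner_mx A q u v = 0.
Proof.
move=> szq; rewrite horner_mx_sum summxE big1 // => i _.
by rewrite mxE adjacency_exp_eq0 ?mulr0 // (leq_trans _ szq).
Qed.

(** At a pair of vertices at distance D, a monic polynomial of degree D in [A] has the same entry as
    [A ^+ D], which is nonzero. *)
Lemma monic_annihilator_size (q : {poly R}) :
  connected_graph e -> q \is monic -> horner_mx A q = 0 ->
  (diameter e < (size q).-1)%N.
Proof.
move=> e_conn qm q0; rewrite ltnNge; apply/negP => szq.
have [u [v uvE]] := diameter_witness e.
(* Shift q to a monic annihilator of degree exactly the diameter. *)
pose r := q * 'X^(diameter e - (size q).-1).
have rm : r \is monic by rewrite monicMr ?monicXn.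
have szr : size r = (diameter e).+1.
  rewrite size_monicM ?monic_neq0 ?monicXn // size_polyXn addnS /=.
  have /prednK qK : (0 < size q)%N by rewrite size_poly_gt0 monic_neq0.
  by rewrite -{1}qK addSn subnKC.
have r0 : horner_mx A r = 0 by rewrite rmorphM /= q0 mul0r.
have := congr1 (fun M : 'M_n.+1 => M u v) r0.
rewrite horner_mx_sum summxE szr big_ord_recr big1 => [|i _] /=; last first.
  by rewrite mxE adjacency_exp_eq0 ?mulr0 // uvE.
have -> : r`_(diameter e) = 1 by move/monicP: rm; rewrite /lead_coef szr.
rewrite add0r scale1r mxE => /eqP; apply/negP.
by rewrite adjacency_exp_neq0 -uvE walk_dist.
Qed.

(** At a coordinate [u] of maximal modulus, [a * x 0 u] is a sum of [k] coordinates, none of larger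
    modulus than [x 0 u]. *)
Lemma eigenvalue_regular (k : nat) (a : R) :
  (forall u, #|[set v | e u v]| = k) -> symmetric e -> eigenvalue A a ->
  `|a| <= k%:R.
Proof.
move=> degk e_sym /eigenvalueP[x xA x0].
have xE u : a * x 0 u = \sum_(w | e u w) x 0 w.
  have /rowP/(_ u) := xA; rewrite !mxE => <-; rewrite [RHS]big_mkcond /=.
  by apply: eq_bigr => w _; rewrite mxE e_sym; case: (e u w);
    rewrite ?mulr1 ?mulr0.
case: (Order.TotalTheory.arg_maxP (fun u => `|x 0 u|) (erefl (predT (@ord0 n))))
  => u _ umax.
have xu_gt0 : 0 < `|x 0 u|.
  rewrite lt_def normr_ge0 andbT; apply: contra x0 => /eqP xu0.
  by apply/eqP/rowP => w; apply/eqP; rewrite mxE -normr_le0 -xu0; apply: umax.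
rewrite -(ler_pM2r xu_gt0) -normrM xE (le_trans (ler_norm_sum _ _ _)) //.
apply: (le_trans (ler_sum _ (fun w _ => umax w isT))).
by rewrite sumr_const mulr_natl -(degk u) cardsE.
Qed.

Lemma adjacency_ones (k : nat) :
  (forall u, #|[set v | e u v]| = k) ->
  A *m const_mx 1 = k%:R *: const_mx 1 :> 'cV_n.+1.
Proof.
move=> degk; apply/matrixP => u j; rewrite !mxE mulr1 -(degk u) cardsE.
rewrite -sum1_card natr_sum [RHS]big_mkcond /=; apply: eq_bigr => w _.
by rewrite !mxE mulr1 unfold_in; case: (e u w).
Qed.

Lemma adjacency_tr : symmetric e -> A^T = A.
Proof. by move=> e_sym; apply/matrixP => u v; rewrite !mxE e_sym. Qed.

Lemma eigenvalue_degree (k : nat) :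
  (forall u, #|[set v | e u v]| = k) -> symmetric e -> eigenvalue A k%:R.
Proof.
move=> degk e_sym; apply/eigenvalueP; exists (const_mx 1).
  apply: trmx_inj; rewrite trmx_mul adjacency_tr // trmx_const.
  by rewrite (adjacency_ones degk) linearZ /= trmx_const.
by apply/eqP => /rowP/(_ ord0)/eqP; rewrite !mxE oner_eq0.
Qed.

Lemma lambda0_regular (k : nat) :
  (forall u, #|[set v | e u v]| = k) -> symmetric e -> lambda R e 0 = k%:R.
Proof.
move=> degk e_sym; have := eigenvalue_degree degk e_sym.
rewrite -mem_spectrum; have := sorted_spectrum R e; rewrite /lambda.
case sE: (spectrum R e) => [|a s] //= srt ks; apply: le_anti.
apply/andP; split.
  apply: le_trans (ler_norm a) _; apply: eigenvalue_regular degk e_sym _.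
  by rewrite -mem_spectrum sE mem_head.
move: ks; rewrite in_cons => /orP[/eqP -> // | ks].
have gtrans : transitive (>%R : rel R).
  by move=> y x z xy yz; apply: lt_trans yz xy.
by have /allP/(_ _ ks)/ltW := order_path_min gtrans srt.
Qed.

(** The all-ones vector is an eigenvector of [A] for [k], hence of [q(A)] for [q(k)]; so every row
    of [q(A)] sums to [q(k)]. *)
Lemma horner_adjacency_ones (k : nat) (q : {poly R}) :
  (forall u, #|[set v | e u v]| = k) ->
  horner_mx A q *m const_mx 1 = q.[k%:R] *: const_mx 1 :> 'cV_n.+1.
Proof.
move=> degk; elim/poly_ind: q => [|q c IHq].
  by rewrite rmorph0 mul0mx horner0 scale0r.
rewrite rmorphD rmorphM /= horner_mx_X horner_mx_C -mulmxE mulmxDl -mulmxA.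
rewrite (adjacency_ones degk) -scalemxAr IHq scalerA mul_scalar_mx hornerMXaddC.
by rewrite -scalerDl [k%:R * _]mulrC.
Qed.

Lemma diameter_le_d : symmetric e -> connected_graph e ->
  (diameter e <= d_ R e)%N.
Proof.
move=> e_sym e_conn; pose q : {poly R} := \prod_(a <- spectrum R e) ('X - a%:P).
have qm : q \is monic by apply: monic_prod_XsubC.
have q0 : horner_mx A q = 0.
  apply: symmetric_annihilator; first exact: adjacency_tr.
  by move=> a; rewrite mem_spectrum.
have := monic_annihilator_size e_conn qm q0.
(* The product has degree [size (spectrum R e)], which is thus above D and so positive; this makes
   the predecessor in [d_] harmless. *)
by rewrite size_prod_XsubC /d_; case: (size _).
Qed.

(** As [q(A)] is symmetric, the trace is the entrywise inner product, comparable with sums over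
    distance matrices. *)
Lemma scalar_product_sum (p q : {poly R}) : symmetric e ->
  scalar_product e p q =
  (\sum_u \sum_v horner_mx A p u v * horner_mx A q u v) / n.+1%:R.
Proof.
move=> e_sym; rewrite /scalar_product; congr (_ / _).
have qT : (horner_mx A q)^T = horner_mx A q.
  by rewrite trmx_horner_mx adjacency_tr.
apply: eq_bigr => u _; rewrite mxE; apply: eq_bigr => v _.
by rewrite -[in LHS]qT mxE.
Qed.

Lemma kbar_sum (m : nat) :
  kbar R e m = (\sum_u \sum_v (dm m u v) ^+ 2) / n.+1%:R.
Proof.
rewrite /kbar; congr (_ / _); apply: eq_bigr => u _.
rewrite /k_ -sum1_card natr_sum big_mkcond /=; apply: eq_bigr => v _.
by rewrite mxE inE; case: (_ == m); rewrite ?expr1n ?expr0n.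
Qed.

(** * The defect identity *)

Section Defect.

Variables (p : nat -> {poly R}) (k m : nat).
Hypotheses (e_sym : symmetric e) (degk : forall u, #|[set v | e u v]| = k).
Hypotheses (p_pre : predistance_polynomials e p) (m_le_d : (m <= d_ R e)%N).
Hypothesis pdr : forall i, (i < m)%N -> horner_mx A (p i) = dm i.

Lemma sum_distance_horner :
  \sum_u \sum_v dm m u v * horner_mx A (p m) u v =
  n.+1%:R * (p m).[lambda R e 0].
Proof.
have [p_size p_orth _] := p_pre.
have n_neq0 : n.+1%:R != 0 :> R by rewrite pnatr_eq0.
rewrite (lambda0_regular degk e_sym).
(* The middle term is the sum of all entries of [p_m(A)], computed from its constant row sums. *)
transitivity (\sum_u \sum_v horner_mx A (p m) u v); last first.
  rewrite mulr_natl -[n.+1 in RHS]card_ord -sumr_const; apply: eq_bigr => u _.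
  have /matrixP/(_ u ord0) := horner_adjacency_ones (p m) degk.
  by rewrite !mxE mulr1 => <-; apply: eq_bigr => v _; rewrite mxE mulr1.
have lower0 : \sum_(i < m) \sum_u \sum_v dm i u v * horner_mx A (p m) u v = 0.
  apply: big1 => i _; rewrite -pdr //.
  have /eqP := p_orth i m (leq_trans (ltnW (ltn_ord i)) m_le_d) m_le_d
    (negbT (ltn_eqF (ltn_ord i))).
  by rewrite scalar_product_sum // mulf_eq0 invr_eq0 (negPf n_neq0) orbF => /eqP.
(* Adding the vanishing terms replaces [dm m] by the sum of the [dm i] with [i <= m]; the comparison
   with the all-ones matrix is then entrywise. *)
rewrite -[LHS]addr0 -[X in _ + X]lower0 [X in _ + X]exchange_big.
rewrite -big_split /=; apply: eq_bigr => u _.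
rewrite [X in _ + X]exchange_big -big_split /=; apply: eq_bigr => v _.
rewrite -mulr_suml mxE -mulrDl.
under eq_bigr do rewrite mxE.
(* Below [m], exactly one [dm i] contributes 1; beyond [m], the entry of [p_m(A)] is 0; at [m], only
   [dm m] contributes. *)
case: (ltngtP (dist e u v) m) => [lt_m|gt_m|->].
- rewrite (bigD1 (Ordinal lt_m)) //= eqxx big1 ?addr0 ?add0r ?mul1r // => i.
  by rewrite -val_eqE /= eq_sym => /negPf->.
- by rewrite horner_adjacency_eq0 ?mulr0 // p_size.
rewrite big1 ?addr0 ?mul1r // => i _.
by rewrite gtn_eqF.
Qed.

Lemma kbar_defect :
  kbar R e m - (p m).[lambda R e 0] =
  (\sum_u \sum_v (dm m u v - horner_mx A (p m) u v) ^+ 2) / n.+1%:R.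
Proof.
have [_ _ p_norm] := p_pre.
have n_neq0 : n.+1%:R != 0 :> R by rewrite pnatr_eq0.
set c := (p m).[_].
have normE : \sum_u \sum_v horner_mx A (p m) u v ^+ 2 = n.+1%:R * c.
  by rewrite /c -p_norm // scalar_product_sum // [RHS]mulrC divfK.
have -> : \sum_u \sum_v (dm m u v - horner_mx A (p m) u v) ^+ 2 =
    \sum_u \sum_v dm m u v ^+ 2 - n.+1%:R * c.
  (* Expanding the square, the cross term is twice [n.+1%:R * c] and the last term is once that,
     which leaves a single subtraction. *)
  transitivity (\sum_u \sum_v dm m u v ^+ 2 -
      (\sum_u \sum_v dm m u v * horner_mx A (p m) u v) *+ 2 +
      \sum_u \sum_v horner_mx A (p m) u v ^+ 2); last first.
    by rewrite sum_distance_horner normE mulr2n opprD addrA subrK.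
  rewrite -sumrMnl -sumrB -big_split /=; apply: eq_bigr => u _.
  rewrite -sumrMnl -sumrB -big_split /=; apply: eq_bigr => v _.
  by rewrite sqrrB.
by rewrite kbar_sum mulrBl [_ * c]mulrC mulfK.
Qed.

End Defect.

End Adjacency.

Unset Implicit Arguments.

Theorem proposition4p6 (R : rcfType) (n : nat) (e : rel 'I_n.+1)
    (e_sym : symmetric e) (e_irr : irreflexive e)
    (e_conn : connected_graph e) (e_reg : regular_graph e)
    (p : nat -> {poly R}) (p_pre : predistance_polynomials e p)
    (m : nat) (m_gt0 : (0 < m)%N) (m_le_D : (m <= diameter e)%N)
    (m1_pdr : partially_distance_regular e p m.-1) :
  (p m).[lambda R e 0] <= kbar R e m /\
  (kbar R e m = (p m).[lambda R e 0] <-> partially_distance_regular e p m).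
Proof.
have [k degk] := e_reg.
have m_le_d := leq_trans m_le_D (diameter_le_d R e_sym e_conn).
have pdr i : (i < m)%N -> horner_mx (adjacency R e) (p i) = distance_mx R e i.
  by move=> lt_im; apply: m1_pdr.2; rewrite -ltnS prednK.
have defect := kbar_defect e_sym degk p_pre m_le_d pdr.
have row_ge0 u : 0 <= \sum_v
    (distance_mx R e m u v - horner_mx (adjacency R e) (p m) u v) ^+ 2.
  by apply: sumr_ge0 => v _; apply: sqr_ge0.
split; first by rewrite -subr_ge0 defect divr_ge0 ?ler0n // sumr_ge0.
split=> [kE|[_ /(_ m (leqnn m)) pE]]; last first.
  apply/eqP; rewrite -subr_eq0 defect pE big1 ?mul0r // => u _.
  by rewrite big1 // => v _; rewrite subrr expr0n.
split=> // i; rewrite leq_eqVlt => /predU1P[-> | /pdr //].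
(* Only index [m] remains: the sum of squares is zero, so each entry of the difference vanishes. *)
move/eqP: defect; rewrite kE subrr eq_sym mulf_eq0 invr_eq0 pnatr_eq0 orbF.
rewrite psumr_eq0 // => /allP rows0; apply/matrixP => u v.
have := rows0 u (mem_index_enum u).
rewrite /= psumr_eq0 => [/allP/(_ v (mem_index_enum v))|w _]; last exact: sqr_ge0.
by rewrite /= sqrf_eq0 subr_eq0 eq_sym => /eqP.
Qed.
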